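(* There is an absolute constant $C$ (given the choice of the constant $a$) such that the following holds. Let $A$ be any matrix from the sample space of isolation matrices described below which satisfies the Chaining Recovery Conditions, and let $\Phi$ be the row tensor product of $A$ with the bit test matrix $B$. Let $f\in\mathbb{R}^d$ with best $m$-term approximation $f_m$. Given the sketch $V=\Phi f$ and the matrix $\Phi$, Chaining Pursuit Proper produces a signal $\widehat f$ with at most $O(m)$ nonzero entries satisfying $$\|f-\widehat f\|_1\le (1+C\log m)\,\|f-f_m\|_1 .$$ In particular, if $f_m=f$ then $\widehat f=f$.
   Context: Signals are vectors in $\mathbb{R}^d$ with coordinates indexed by $\{0,\dots,d-1\}$; $f_m$ keeps the $m$ largest-magnitude coordinates of $f$ and zeroes the rest. Sample space. Fix a sufficiently large constant $a$; $m_k=m/a^k$; passes $k=0,\dots,K-1$, $K=1+\lfloor\log_a m\rfloor$; $T_k=\lceil c_1(k+1)\log d\rceil$, $r_k=\lceil c_2m/2^k\rceil$ with $c_1,c_2$ depending on $a$. An isolation matrix $A$ is a $0$-$1$ matrix stacking blocks (trials) $A^{(k)}_t$, $0\le k<K$, $1\le t\le T_k$, each $r_k\times d$ with exactly one $1$ per column (a partition of the positions into $r_k$ rows, called measurements). With $L=\lceil\log_2 d\rceil$, the bit test matrix $B$ has row $0$ all ones and rows $\beta_i$ ($0\le i<L$) with a $1$ in column $j$ iff the $i$-th binary digit of $j$ is $1$. The row tensor product $\Phi$ has rows $\beta\alpha$ (componentwise product) for all rows $\beta$ of $B$ and $\alpha$ of $A$. Chaining Recovery Conditions (CRC). Call a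 vector admissible at pass $k$ if it equals $s+w+\sum_{j=0}^{k-1}\nu_j$ where $s$ has at most $m_k$ nonzero entries (its support positions are called spikes), $\|w\|_1=1/(400000a)$, and each $\nu_j$ has at most $3m_j$ nonzero entries, each of magnitude at most $2/m_j$. $A$ satisfies the CRC if for every pass $k$ and every admissible vector at pass $k$, at least $99/100$ of the trials $A^{(k)}_t$ satisfy: (1) all but at most $m_{k+1}/100$ spikes lie in a row of $A^{(k)}_t$ containing no other spike; (2) all but at most $m_{k+1}/100$ rows $\alpha$ of $A^{(k)}_t$ satisfy $\sum_{j:\alpha_j=1}|(w+\sum_{i<k}\nu_i)_j|\le 1/(1000m_k)$. Chaining Pursuit Proper. For a row $\alpha$ of $A$ and vector $g$, the measurement consists of $c=\langle\alpha,g\rangle$ and $b(i)=\langle\alpha\beta_i,g\rangle$; it is decoded into the position whose $i$-th binary digit is $1$ iff $|b(i)|\ge|c-b(i)|$, with value $c$. Keeping an approximation $h$ (initially $0$) and residual sketch $V-\Phi h$, in pass $k$: in each trial all rows of $A^{(k)}_t$ are decoded; per position the largest-magnitude value is kept and the $m_k$ positions of largest kept magnitude are retained; positions retained in at least $9/10$ of the trials are selected and assigned the median of their estimated values over the trials; the resulting vector is added to $h$. The output is $h$ after the last pass (no pruning).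
   Formalization: For m = 1 the factor log m is read as log 2, since the literal bound with log 1 = 0 fails (one-row blocks, f = e_0 plus small positive noise gives twice the error); d ≥ 2 is assumed because for d = 1 there are no trials and the sketch is empty. *)

(* Defs.v *)
From mathcomp Require Import all_boot all_order all_algebra.
From mathcomp Require Import reals exp.

Set Implicit Arguments.
Unset Strict Implicit.
Unset Printing Implicit Defensive.

Import Order.TTheory GRing.Theory Num.Theory.
Local Open Scope ring_scope.

Section Generic.
Variable R : realType.

Definition l1norm d (g : 'cV[R]_d) : R := \sum_j `|g j 0|.

Definition supp d (g : 'cV[R]_d) : {set 'I_d} := [set j | g j 0 != 0].

(* S consists of the n elements of D with largest weight (all of D if
   #|D| <= n); ties are broken arbitrarily. *)
Definition is_top d (n : nat) (D : {set 'I_d}) (weight : 'I_d -> R)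
    (S : {set 'I_d}) : Prop :=
  [/\ S \subset D, #|S| = minn n #|D| &
      forall i j, i \in S -> j \in D :\: S -> weight j <= weight i].

Definition best_approx d (m : nat) (f fm : 'cV[R]_d) : Prop :=
  exists2 S : {set 'I_d}, is_top m setT (fun j => `|f j 0|) S &
    fm = \col_j (if j \in S then f j 0 else 0).

(* For an even number of samples, every point between the two middle ones
   is a median. *)
Definition is_median (I : finType) (P : {set I}) (x : I -> R) (mu : R) : Prop :=
  (#|P| <= 2 * #|[set i in P | (x i <= mu)%R]|)%N /\
  (#|P| <= 2 * #|[set i in P | (mu <= x i)%R]|)%N.

Definition bit (i j : nat) : bool := odd (j %/ 2 ^ i).

(* up_log 2 d is the ceiling of log_2 d; row ord0 is the all-ones row and row
   (lift ord0 i) is beta_i. *)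
Definition bit_test (d : nat) : 'M[R]_((up_log 2 d).+1, d) :=
  \matrix_(i, j) if unlift ord0 i is Some i' then (bit i' j)%:R else 1.

(* The row with index (mxvec_index b n) is the componentwise product of row b
   of B and row n of A. *)
Definition row_tensor p q d (B : 'M[R]_(p, d)) (A : 'M[R]_(q, d)) :
    'M[R]_(p * q, d) :=
  \matrix_(i, j) mxvec (\matrix_(b, n) (B b j * A n j)) 0 i.

End Generic.

Section ChainingPursuit.
Variables (R : realType) (a c1 c2 : R) (d m : nat).

(* sparsity k is m_k, a real number; npasses is K, ntrials k is T_k and
   nrows k is r_k. *)
Definition sparsity (k : nat) : R := m%:R / a ^+ k.

Definition npasses : nat := (Num.truncn (ln (m%:R : R) / ln a)).+1.

Definition ntrials (k : nat) : nat :=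
  `|Num.ceil (c1 * k.+1%:R * ln (d%:R : R))|%N.

Definition nrows (k : nat) : nat := `|Num.ceil (c2 * m%:R / 2 ^+ k)|%N.

Definition nmeas : nat := \sum_(k < npasses) \sum_(t < ntrials k) nrows k.

Definition block q (A : 'M[R]_(nmeas, q)) (k : 'I_npasses)
    (t : 'I_(ntrials k)) : 'M[R]_(nrows k, q) :=
  submxcol (submxcol A k) t.

Definition isolation_matrix (A : 'M[R]_(nmeas, d)) : Prop :=
  (forall n j, A n j = 0 \/ A n j = 1) /\
  forall (k : 'I_npasses) (t : 'I_(ntrials k)) (j : 'I_d),
    #|[set n | block A t n j == 1]| = 1%N.

Definition Phi (A : 'M[R]_(nmeas, d)) :
    'M[R]_((up_log 2 d).+1 * nmeas, d) :=
  row_tensor (bit_test R d) A.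

(* The decomposition s + w + \sum_j nu j exhibits an admissible vector. *)
Definition admissible (k : nat) (s w : 'cV[R]_d) (nu : 'I_k -> 'cV[R]_d) :
    Prop :=
  [/\ #|supp s|%:R <= sparsity k,
      l1norm w = (4 * 10 ^+ 5 * a)^-1 &
      forall j : 'I_k, #|supp (nu j)|%:R <= 3 * sparsity j /\
        forall i, `|nu j i 0| <= 2 / sparsity j].

Definition isolated q (M : 'M[R]_(q, d)) (s : 'cV[R]_d) (j : 'I_d) : bool :=
  [exists n, (M n j == 1) && [forall i in supp s :\ j, M n i != 1]].

Definition good_trial q (M : 'M[R]_(q, d)) (k : nat) (s noise : 'cV[R]_d) :
    bool :=
  (#|[set j in supp s | ~~ isolated M s j]|%:R <= sparsity k.+1 / 100) &&
  (#|[set n | ~~ (\sum_(j | M n j == 1) `|noise j 0|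
                    <= (1000 * sparsity k)^-1)]|%:R
     <= sparsity k.+1 / 100).

Definition CRC (A : 'M[R]_(nmeas, d)) : Prop :=
  forall (k : 'I_npasses) (s w : 'cV[R]_d) (nu : 'I_k -> 'cV[R]_d),
    admissible s w nu ->
    99 / 100 * (ntrials k)%:R <=
      #|[set t : 'I_(ntrials k) |
           good_trial (block A t) k s (w + \sum_(i < k) nu i)]|%:R :> R.

(* One row of M holds the data of one measurement: c in column ord0 and b(i)
   in column (lift ord0 i). Since d <= 2 ^ up_log 2 d, a measurement decodes
   to at most one j < d; it decodes to none, and is then ignored, when its
   binary digits encode a number >= d. *)
Definition decodes q (M : 'M[R]_(q, (up_log 2 d).+1)) (n : 'I_q) (j : 'I_d) :
    bool :=
  [forall i : 'I_(up_log 2 d),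
    bit i j == (`|M n ord0 - M n (lift ord0 i)| <= `|M n (lift ord0 i)|)].

Definition decoded q (M : 'M[R]_(q, (up_log 2 d).+1)) : {set 'I_d} :=
  [set j | [exists n, decodes M n j]].

(* m_k need not be an integer, so floor (m_k) positions are retained. S is the
   set of positions retained in the trial, and v j is the kept value of j. *)
Definition trial_outcome q (M : 'M[R]_(q, (up_log 2 d).+1)) (k : nat)
    (S : {set 'I_d}) (v : 'I_d -> R) : Prop :=
  (forall j, j \in decoded M ->
     exists n, [/\ decodes M n j, v j = M n ord0 &
       forall n', decodes M n' j -> `|M n' ord0| <= `|v j|]) /\
  is_top (Num.truncn (sparsity k)) (decoded M) (fun j => `|v j|) S.

(* U is the residual sketch. The matrix (vec_mx U^T)^T has the rows of the
   isolation matrix as row indices and the rows of the bit test matrix as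
   column indices. *)
Definition pass (k : 'I_npasses) (U : 'cV[R]_((up_log 2 d).+1 * nmeas))
    (h h' : 'cV[R]_d) : Prop :=
  exists (S : 'I_(ntrials k) -> {set 'I_d}) (v : 'I_(ntrials k) -> 'I_d -> R),
    (forall t, trial_outcome (block (vec_mx U^T)^T t) k (S t) (v t)) /\
    forall j : 'I_d,
      let J := [set t | j \in S t] in
      if 9 / 10 * (ntrials k)%:R <= #|J|%:R :> R
      then exists2 mu, is_median J (v^~ j) mu & h' j 0 = h j 0 + mu
      else h' j 0 = h j 0.

(* A relation, because the choices among ties and among medians are left
   open. *)
Definition chaining_pursuit_proper
    (F : 'M[R]_((up_log 2 d).+1 * nmeas, d))
    (V : 'cV[R]_((up_log 2 d).+1 * nmeas)) (fhat : 'cV[R]_d) : Prop :=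
  exists h : nat -> 'cV[R]_d,
    [/\ h 0%N = 0,
        forall k : 'I_npasses, pass k (V - F *m h k) (h k) (h k.+1) &
        fhat = h npasses].

End ChainingPursuit.

(* Main.v *)
Require Import Defs.
From mathcomp Require Import all_boot all_order all_algebra.
From mathcomp Require Import reals exp.
From mathcomp Require Import lra ring zify.

Import Order.TTheory GRing.Theory Num.Theory.
Local Open Scope ring_scope.

(** Fix a scale [mu > 0] with [|f - f_m|_1 <= mu / (400000 a)]. Before pass [k]
    the residual is [s + (f - f_m) + \sum_(i < k) nu_i], with at most [m_k]
    spikes in [s] and [nu_i] as in the recovery conditions, scaled by [mu].
    Put [delta = mu / (1000 m_k)]. In a good trial a row with noise at most
    [delta] and at most one spike is decoded correctly as soon as its spike
    exceeds [delta]; the other rows are few, hence so are the positions that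
    they decode to, the spikes that they hide and the spikes that they push out
    of the [m_k] retained positions. So all but [6 m_(k+1) / 100] positions are
    treated correctly up to an error [5 delta], and double counting over the
    trials leaves fewer than [m_(k+1)] positions with a wrong final decision:
    they are the new spikes, and the errors at the other positions form [nu_k].
    After the last pass there are fewer than [m_K < 1] spikes, and each [nu_i]
    costs at most [6 mu]. Letting [mu] decrease to [400000 a |f - f_m|_1] also
    covers exact recovery, where this limit is [0]. *)

(** * Binary digits, double counting, largest elements and medians *)

Lemma bit_inj (L j1 j2 : nat) : (j1 < 2 ^ L)%N -> (j2 < 2 ^ L)%N ->
  (forall i, (i < L)%N -> bit i j1 = bit i j2) -> j1 = j2.
Proof.
elim: L j1 j2 => [|L IHL] j1 j2.
  by rewrite expn0 !ltnS !leqn0 => /eqP -> /eqP ->.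
move=> lt1 lt2 eqb.
have half_eq : (j1 %/ 2 = j2 %/ 2)%N.
  apply: IHL; rewrite ?ltn_divLR // -?expnSr // => i ltiL.
  by have := eqb i.+1 ltiL; rewrite /bit expnS !divnMA.
have := eqb 0%N (ltn0Sn L); rewrite /bit expn0 !divn1 => eq_odd.
by rewrite (divn_eq j1 2) (divn_eq j2 2) half_eq !modn2 eq_odd.
Qed.

(** The number of pairs [(j, t)] with [j \in F] and [j \in B t] lies between the two sides. *)
Lemma double_counting (R : realFieldType) (I J : finType) (B : I -> {set J})
    (F : {set J}) (x y : R) :
  (forall j, j \in F -> x <= #|[set t | j \in B t]|%:R) ->
  (forall t, #|B t|%:R <= y) ->
  #|F|%:R * x <= #|I|%:R * y.
Proof.
move=> lbF ubB.
have -> : #|F|%:R * x = \sum_(j in F) x by rewrite sumr_const mulr_natl.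
have -> : #|I|%:R * y = \sum_(t : I) y by rewrite sumr_const mulr_natl.
apply: (@le_trans _ _ (\sum_(j in F) \sum_(t : I) (j \in B t)%:R)).
  apply: ler_sum => j jF; apply: le_trans (lbF j jF) _.
  by rewrite -natr_sum ler_nat -sum1dep_card big_mkcond /=; apply: leq_sum => t _; case: ifP.
rewrite exchange_big; apply: ler_sum => t _; apply: le_trans (ubB t).
rewrite -natr_sum ler_nat -sum1_card [X in (_ <= X)%N]big_mkcond /=.
rewrite big_mkcond; apply: leq_sum => j _.
by case: (j \in F); case: (j \in B t).
Qed.

Lemma set_argmax (R : realType) (I : finType) (P : {set I}) (x : I -> R) i0 :
  i0 \in P -> exists2 i, i \in P & forall j, j \in P -> x j <= x i.
Proof. by move=> i0P; have [i] := arg_maxP (P := mem P) x i0P; exists i. Qed.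
Arguments set_argmax [R I P] x [i0].

Lemma is_top_exists (R : realType) d n (D : {set 'I_d}) (wt : 'I_d -> R) :
  exists S, is_top n D wt S.
Proof.
elim: n => [|n [S [sSD cardS topS]]].
  by exists set0; split=> [||i j]; rewrite ?sub0set ?cards0 ?min0n // inE.
have [DS0 | [i0 i0DS]] := set_0Vmem (D :\: S).
  have eqSD : S = D by apply/eqP; rewrite eqEsubset sSD -setD_eq0 DS0 eqxx.
  exists S; split=> [||i j _]; [by [] | | by rewrite DS0 inE].
  by move: cardS; rewrite eqSD; lia.
have [i iDS imax] := set_argmax wt i0DS.
move: (iDS); rewrite in_setD => /andP[iS iD].
exists (i |: S); split.
- by rewrite subUset sub1set iD sSD.
- have : (#|S| < #|D|)%N.
    by apply: proper_card; apply/properP; split=> //; exists i.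
  by rewrite cardsU1 iS; move: cardS; lia.
- move=> j1 j2; rewrite !inE negb_or => /orP[/eqP -> | j1S] /andP[/andP[_ j2S] j2D].
    by apply: imax; rewrite inE j2S.
  by apply: topS; rewrite // inE j2S.
Qed.

(** For nonempty [P], the least sample value with at least half of the samples at or below it is a
    median: if fewer than half lay at or above it, the largest smaller sample would have this
    property too. *)
Lemma is_median_exists (R : realType) (I : finType) (P : {set I}) (x : I -> R) :
  exists mu, is_median P x mu.
Proof.
have [-> | [i0 i0P]] := set_0Vmem P; first by exists 0; rewrite /is_median cards0.
pose half i := (i \in P) && (#|P| <= 2 * #|[set j in P | (x j <= x i)%R]|)%N.
have [im imP immax] := set_argmax x i0P.
have halfm : half im.
  rewrite /half imP (_ : [set j in P | _] = P) ?leq_pmull //.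
  by apply/setP => j; rewrite inE andb_idr // => /immax.
have [i /andP[iP ihalf] imin] := arg_minP x halfm.
exists (x i); split=> //.
rewrite leqNgt; apply/negP => few.
pose Q := [set j in P | (x j < x i)%R].
have PE : #|P| = (#|Q| + #|[set j in P | (x i <= x j)%R]|)%N.
  rewrite -(cardsID [set j | x j < x i] P); congr (_ + _)%N.
    by apply: eq_card => j; rewrite !inE.
  by apply: eq_card => j; rewrite !inE -leNgt andbC.
have [j0 j0Q] : exists j, j \in Q.
  by apply/card_gt0P; move: few PE; lia.
have [j jQ jmax] := set_argmax x j0Q.
move: (jQ); rewrite inE => /andP[jP ltji].
suff /imin : half j by rewrite leNgt ltji.
rewrite /half jP; have sQ : Q \subset [set i' in P | x i' <= x j].
  apply/subsetP => i' i'Q; rewrite inE (jmax _ i'Q) andbT.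
  by move: i'Q; rewrite inE => /andP[].
by have := subset_leq_card sQ; move: few PE; lia.
Qed.

(** The samples at or beyond the median, seen from [c], are at least as far from [c], and they make
    up at least half of [P]. *)
Lemma median_near (R : realType) (I : finType) (P : {set I}) (x : I -> R)
    (mu c eps : R) :
  is_median P x mu -> eps < `|mu - c| ->
  (#|P| <= 2 * #|[set i in P | (eps < `|x i - c|)%R]|)%N.
Proof.
move=> [lo hi] far; have [le_mu | lt_mu] := lerP c mu.
  apply: leq_trans hi _; rewrite leq_mul2l /=; apply/subset_leq_card/subsetP => i.
  rewrite !inE => /andP[-> /= le_x]; apply: lt_le_trans far _.
  by rewrite !ger0_norm; lra.
apply: leq_trans lo _; rewrite leq_mul2l /=; apply/subset_leq_card/subsetP => i.
rewrite !inE => /andP[-> /= le_x]; apply: lt_le_trans far _.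
by rewrite !ler0_norm; lra.
Qed.

Lemma decodes_inj (R : realType) d q (X : 'M[R]_(q, (up_log 2 d).+1)) n
    (i j : 'I_d) : decodes X n i -> decodes X n j -> i = j.
Proof.
move=> /forallP di /forallP dj; apply: val_inj.
have lt_d (k : 'I_d) : (k < 2 ^ up_log 2 d)%N.
  exact: leq_trans (ltn_ord k) (up_logP _ _).
apply: (bit_inj _ _ _ (lt_d i) (lt_d j)) => k ltk.
have := di (Ordinal ltk); have := dj (Ordinal ltk).
by move=> /eqP /= -> /eqP /= ->.
Qed.

Arguments decodes_inj {R d q X n i j}.

(** * Analysis of a single trial *)

Section Trial.
Variables (R : realType) (d q : nat) (r : 'I_d -> 'I_q).
Variables (s e : 'cV[R]_d) (delta : R) (X : 'M[R]_(q, (up_log 2 d).+1)).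
Hypothesis delta_ge0 : 0 <= delta.
Hypothesis XE : forall n b,
  X n b = \sum_(j | r j == n) bit_test R d b j * (s + e) j 0.

Definition quiet (n : 'I_q) := \sum_(j | r j == n) `|e j 0| <= delta.

Definition alone (j : 'I_d) := [forall i in supp s :\ j, r i != r j].

(** In such a row at most one spike competes with the noise; the exceptions in a trial are all
    traced back to rows that fail this. *)
Definition clean (n : 'I_q) := quiet n &&
  [forall i in supp s, forall j in supp s, (r i == n) && (r j == n) ==> (i == j)].

Lemma bit_test0 b j : bit_test R d b j = 0 \/ bit_test R d b j = 1.
Proof. by rewrite mxE; case: unliftP => [i|] _; [case: (bit i j)|]; [right|left|right]. Qed.

(* The row reads [sigma] at position [p] up to errors which, for each bit, add
   up to at most [delta]; the bit test at [p] is then the comparison of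
   [sigma] with noise. *)
Lemma row_reading n p sigma : quiet n ->
    (forall b, \sum_(j | r j == n) bit_test R d b j * s j 0 =
               bit_test R d b p * sigma) ->
  `|X n ord0 - sigma| <= delta /\ (delta < `|sigma| -> decodes X n p).
Proof.
move=> quiet_n sE.
pose E b := \sum_(j | r j == n) bit_test R d b j * e j 0.
have XnE b : X n b = bit_test R d b p * sigma + E b.
  by rewrite XE -sE -big_split /=; apply: eq_bigr => j _; rewrite !mxE mulrDr.
have B0 j : bit_test R d ord0 j = 1 by rewrite mxE unlift_none.
(* A 0-1 row of the bit test matrix splits the positions of the measurement into two disjoint
   groups; [E b] and [E ord0 - E b] are the noise on each, so together they cost at most the noise
   of the row. *)
have Ele b : `|E ord0 - E b| + `|E b| <= delta.
  apply: le_trans quiet_n; rewrite /E -sumrB.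
  apply: le_trans (lerD (ler_norm_sum _ _ _) (ler_norm_sum _ _ _)) _.
  rewrite -big_split /=; apply: ler_sum => j _; rewrite B0 mul1r.
  by case: (bit_test0 b j) => ->; rewrite ?mul0r ?mul1r ?subr0 ?subrr ?normr0 ?addr0 ?add0r.
split=> [|lt_sigma].
  by have := Ele ord0; rewrite XnE B0 mul1r subrr normr0 add0r addrC addKr.
apply/forallP => i; have := Ele (lift ord0 i).
rewrite !XnE B0 mxE liftK mul1r; set E1 := E (lift _ _).
case: (bit i p) => Eb; rewrite ?mul1r ?mul0r ?add0r.
  rewrite eq_sym; apply/eqP; apply/idP.
  have -> : sigma + E ord0 - (sigma + E1) = E ord0 - E1 by ring.
  have := lerB_normD sigma E1; lra.
rewrite eq_sym; apply/eqP; apply/negbTE; rewrite -ltNge.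
have -> : sigma + E ord0 - E1 = sigma + (E ord0 - E1) by ring.
have := lerB_normD sigma (E ord0 - E1); lra.
Qed.

Lemma clean_spike n p : clean n -> p \in supp s -> r p = n ->
  `|X n ord0 - s p 0| <= delta /\ (delta < `|s p 0| -> decodes X n p).
Proof.
move=> /andP[quiet_n /forall_inP uniq_n] ps rp; apply: row_reading => // b.
rewrite (bigD1 p) ?rp //= big1 ?addr0 // => j /andP[/eqP rj neq_jp].
have [js|] := boolP (j \in supp s); last first.
  by rewrite inE negbK => /eqP ->; rewrite mulr0.
have /forall_inP/(_ p ps) := uniq_n j js.
by rewrite rj rp eqxx (negPf neq_jp).
Qed.

(** A clean row with a spike above [delta] decodes to that spike only; with a smaller spike or none,
    its value is at most [2 * delta] in magnitude, whatever position it decodes to. *)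
Lemma clean_value n j : clean n -> decodes X n j ->
  `|X n ord0| <= 2 * delta \/
  [/\ j \in supp s, r j = n & `|X n ord0 - s j 0| <= delta].
Proof.
move=> clean_n dec_j.
have [/existsP[p /andP[ps /eqP rp]] | none] :=
    boolP [exists p, (p \in supp s) && (r p == n)].
  have [near dec_p] := clean_spike n p clean_n ps rp.
  have [small | /dec_p dec_p'] := lerP `|s p 0| delta.
    left; have := lerB_dist (X n ord0) (s p 0); lra.
  by right; rewrite (decodes_inj dec_j dec_p').
left; have /andP[quiet_n _] := clean_n.
have [|le_delta _] := row_reading n j 0 quiet_n.
  move=> b; rewrite mulr0 big1 // => i /eqP ri; apply/eqP.
  move: none; rewrite negb_exists => /forallP/(_ i).
  by rewrite ri eqxx andbT inE negbK => /eqP ->; rewrite mulr0.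
move: le_delta; rewrite subr0; have := delta_ge0; lra.
Qed.

Definition dirty_position : {set 'I_d} :=
  [set j | [exists n, ~~ clean n && decodes X n j]].

Definition dirty_spike : {set 'I_d} := [set j in supp s | ~~ clean (r j)].

(** A quiet row that is not clean holds two spikes, hence is the image under [r] of a spike that is
    not alone. *)
Lemma card_dirty_rows :
  (#|[set n | ~~ clean n]| <=
     #|[set n | ~~ quiet n]| + #|[set j in supp s | ~~ alone j]|)%N.
Proof.
apply: leq_trans (leq_add (leqnn _) (leq_imset_card r _)).
apply: leq_trans (leq_card_setU _ _); apply/subset_leq_card/subsetP => n.
rewrite !inE negb_and; case: (quiet n) => //= /forall_inPn[i iS] /forall_inPn[j jS].
rewrite negb_imply => /andP[/andP[/eqP ri /eqP rj] neq_ij].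
apply/imsetP; exists i; rewrite ?ri // !inE.
move: (iS); rewrite inE => -> /=.
apply/forall_inPn; exists j; last by rewrite negbK ri rj.
by rewrite in_setD1 eq_sym neq_ij.
Qed.

Lemma card_dirty_position :
  (#|dirty_position| <=
     #|[set n | ~~ quiet n]| + #|[set j in supp s | ~~ alone j]|)%N.
Proof.
apply: leq_trans card_dirty_rows.
have [-> | [j0 _]] := set_0Vmem dirty_position; first by rewrite cards0.
(* A row decodes to at most one position, so [dec] reaches every dirty position; [j0] only fills in
   for rows that decode to none. *)
pose dec n := odflt j0 [pick j | decodes X n j].
apply: leq_trans (leq_imset_card dec _); apply/subset_leq_card/subsetP => j.
rewrite inE => /existsP[n /andP[dirty_n dec_j]].
apply/imsetP; exists n; first by rewrite inE.
rewrite /dec; case: pickP => [i dec_i | /(_ j)]; last by rewrite dec_j.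
exact: decodes_inj dec_j dec_i.
Qed.

(** A dirty row may hold many spikes, so counting rows does not suffice. Spikes that are not alone
    are counted directly; one that is alone owns its row, which can then be dirty only by not being
    quiet. *)
Lemma card_dirty_spike :
  (#|dirty_spike| <=
     #|[set n | ~~ quiet n]| + #|[set j in supp s | ~~ alone j]|)%N.
Proof.
pose I := [set j in dirty_spike | alone j].
have rI : {in I &, injective r}.
  move=> i j; rewrite !inE => /andP[/andP[si _] _] /andP[_ /forall_inP al_j] eq_r.
  apply/eqP/negPn/negP => neq_ij.
  by have := al_j i; rewrite in_setD1 neq_ij inE si eq_r eqxx => /(_ isT).
apply: (@leq_trans (#|I| + #|[set j in supp s | ~~ alone j]|)).
  apply: leq_trans (leq_card_setU _ _); apply/subset_leq_card/subsetP => j.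
  by rewrite !inE => /andP[-> ->]; case: (alone j).
rewrite leq_add2r -(card_in_imset rI); apply/subset_leq_card/subsetP => n.
case/imsetP => j jI ->; rewrite inE; move: jI.
rewrite in_set => /andP[]; rewrite in_set => /andP[sj dirty_j] /forall_inP al_j.
move: dirty_j; rewrite negb_and => /orP[// | ].
move=> /forall_inPn[i1 s1] /forall_inPn[i2 s2].
rewrite negb_imply => /andP[/andP[/eqP r1 /eqP r2] neq12].
have eqj i : i \in supp s -> r i = r j -> i = j.
  move=> si ri; apply/eqP/negPn/negP => neq.
  by have := al_j i; rewrite in_setD1 neq si ri eqxx => /(_ isT).
by move: neq12; rewrite (eqj _ s1 r1) (eqj _ s2 r2) eqxx.
Qed.

Variables (a : R) (m k : nat) (S : {set 'I_d}) (v : 'I_d -> R).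
Hypothesis outcome : trial_outcome a m X k S v.
Hypothesis sparse : #|supp s|%:R <= sparsity a m k.

Lemma kept_value j : j \in decoded X -> j \notin dirty_position ->
  `|v j| <= 2 * delta \/ j \in supp s /\ `|v j - s j 0| <= delta.
Proof.
move=> dec_j; rewrite inE negb_exists => /forallP clean_j.
have [/(_ j dec_j) [n [dec_n -> _]] _] := outcome.
have cl : clean n by have := clean_j n; rewrite dec_n andbT negbK.
by case: (clean_value n j cl dec_n) => [|[]]; auto.
Qed.

(** Above [3 * delta] a spike reads more than [2 * delta] in its own row, so the kept value is too
    large for the first alternative of [kept_value]. *)
Lemma kept_spike j : j \in supp s -> j \notin dirty_position ->
    j \notin dirty_spike -> 3 * delta < `|s j 0| ->
  [/\ j \in decoded X, 2 * delta < `|v j| & `|v j - s j 0| <= delta].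
Proof.
move=> js cl_pos cl_spike large.
have cl : clean (r j) by move: cl_spike; rewrite inE js /= negbK.
have [near dec] := clean_spike (r j) j cl js erefl.
have dec_j : decodes X (r j) j by apply: dec; move: delta_ge0; lra.
have jD : j \in decoded X by rewrite inE; apply/existsP; exists (r j).
have big : 2 * delta < `|X (r j) ord0|.
  have := lerB_dist (s j 0) (X (r j) ord0); rewrite distrC; move: delta_ge0; lra.
have [/(_ j jD) [n [dec_n vE /(_ _ dec_j) vmax]] _] := outcome.
have vbig : 2 * delta < `|v j| by apply: lt_le_trans vmax.
split=> //; case: (kept_value j jD cl_pos) => [|[]//].
by move=> le; have := lt_le_trans vbig le; rewrite ltxx.
Qed.

Definition crowded_out : {set 'I_d} :=
  [set j | [&& j \in decoded X :\: S, 2 * delta < `|v j|,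
    j \in supp s & j \notin dirty_position]].

(* If some spike is crowded out, then all [m_k] places are taken, and only by
   spikes and dirty positions. *)
Lemma card_crowded_out : (#|crowded_out| <= #|dirty_position|)%N.
Proof.
have [-> | [j0]] := set_0Vmem crowded_out; first by rewrite cards0.
rewrite inE => /and4P[j0D j0big _ _].
have [_ [SD cardS topS]] := outcome.
have sub : S :|: crowded_out \subset supp s :|: dirty_position.
  rewrite subUset; apply/andP; split; apply/subsetP => j; last first.
    by rewrite !inE => /and4P[_ _ -> _].
  move=> jS; rewrite in_setU; have [|cl] := boolP (j \in dirty_position).
    by rewrite orbT.
  have := topS j j0 jS j0D.
  case: (kept_value j (subsetP SD _ jS) cl) => [le1 le2 | [-> //]].
  by have := lt_le_trans j0big (le_trans le2 le1); rewrite ltxx.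
have dis : S :&: crowded_out = set0.
  by apply/setP => j; rewrite !inE; case: (j \in S).
have cardle := subset_leq_card sub.
have := leq_trans cardle (leq_card_setU _ _); rewrite cardsU dis cards0 subn0.
(* A decoded position is left out, so [S] has its full size, which is at least the number of spikes;
   by [sub] the crowded-out positions are then no more than the dirty ones. *)
have : (#|S| < #|decoded X|)%N.
  apply: proper_card; apply/properP; split=> //.
  by exists j0; move: j0D; rewrite inE => /andP[].
have : (#|supp s| <= Num.truncn (sparsity a m k))%N.
  by rewrite truncn_ge_nat // (le_trans _ sparse).
by move: cardS; lia.
Qed.

Lemma trial_exceptions : exists Bad : {set 'I_d},
  (#|Bad| <= 3 * (#|[set n | ~~ quiet n]| + #|[set j in supp s | ~~ alone j]|))%N /\
  forall j, j \notin Bad ->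
    (3 * delta < `|s j 0| -> j \in S) /\ (j \in S -> `|v j - s j 0| <= 5 * delta).
Proof.
exists (dirty_position :|: dirty_spike :|: crowded_out); split.
  apply: leq_trans (leq_card_setU _ _) _.
  have : (_ <= _)%N := leq_card_setU dirty_position dirty_spike.
  have := card_dirty_position; have := card_dirty_spike.
  by have := card_crowded_out; lia.
move=> j; rewrite !in_setU !negb_or => /andP[/andP[cl_pos cl_spike] cr].
have large_spike : 3 * delta < `|s j 0| -> j \in supp s.
  by move=> large; rewrite inE -normr_gt0; apply: le_lt_trans large; move: delta_ge0; lra.
split=> [large | jS].
  have js := large_spike large.
  have [jD vbig _] := kept_spike j js cl_pos cl_spike large.
  by move: cr; rewrite inE in_setD jD vbig js cl_pos !andbT negbK.
(* The worst case is a spike up to [3 * delta] with a kept value up to [2 * delta], whence the error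
   [5 * delta]. *)
have [small | large] := lerP `|s j 0| (3 * delta); last first.
  have [_ _] := kept_spike j (large_spike large) cl_pos cl_spike large; move: delta_ge0; lra.
have [_ [SD _ _]] := outcome.
case: (kept_value j (subsetP SD _ jS) cl_pos) => [le2 | [_]]; last by move: delta_ge0; lra.
by have := ler_normB (v j) (s j 0); move: delta_ge0; lra.
Qed.

End Trial.

(** * The vote over the trials of a pass *)

(* If [j] is misestimated, then at least 1/10 of the trials misjudge it: at
   least 1/10 fail to retain it, or half of the 9/10 that retain it give a
   wrong value. At most 1/100 of the trials are not good, so at least 9/100
   are good trials that misjudge it. *)
Lemma vote_exceptions (R : realType) d (I : finType) (S Bad : I -> {set 'I_d})
    (v : I -> 'I_d -> R) (s D : 'I_d -> R) (Good : {set I}) (delta beta sigma : R) :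
  (0 < #|I|)%N -> 0 <= delta -> 0 <= beta ->
  99 / 100 * #|I|%:R <= #|Good|%:R :> R ->
  (forall t, t \in Good -> #|Bad t|%:R <= beta) ->
  (forall t j, t \in Good -> j \notin Bad t ->
     (3 * delta < `|s j| -> j \in S t) /\
     (j \in S t -> `|v t j - s j| <= 5 * delta)) ->
  (forall t, #|S t|%:R <= sigma) ->
  (forall j, let J := [set t | j \in S t] in
     if 9 / 10 * #|I|%:R <= #|J|%:R :> R
     then exists2 mu, is_median J (v^~ j) mu & D j = mu else D j = 0) ->
  exists Fail Sel : {set 'I_d},
    [/\ 9 * #|Fail|%:R <= 100 * beta, 9 * #|Sel|%:R <= 10 * sigma,
        forall j, j \notin Sel -> D j = 0 &
        forall j, j \notin Fail -> `|s j - D j| <= 5 * delta].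
Proof.
move=> I_gt0 delta_ge0 beta_ge0 many_good card_Bad ok card_S select.
have T_gt0 : 0 < #|I|%:R :> R by rewrite ltr0n.
exists [set j | 5 * delta < `|s j - D j|].
exists [set j | 9 / 10 * #|I|%:R <= #|[set t | j \in S t]|%:R :> R].
split.
(* [Bad t] is bounded for good trials only, so it is emptied elsewhere. *)
- pose Bad' t := if t \in Good then Bad t else set0.
  suff : #|[set j | 5 * delta < `|s j - D j|]|%:R * (9 / 100 * #|I|%:R)
      <= #|I|%:R * beta.
    move: #|[set j | _]|%:R => x le.
    have : #|I|%:R * (9 * x) <= #|I|%:R * (100 * beta) by lra.
    by rewrite ler_pM2l.
  apply: (@double_counting _ _ _ Bad') => [j | t]; last first.
    by rewrite /Bad'; case: ifP => [/card_Bad // | _]; rewrite cards0.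
  rewrite inE => wrong; pose J := [set t | j \in S t].
  have [W W_large W_Bad] : exists2 W : {set I}, 1 / 10 * #|I|%:R <= #|W|%:R :> R &
      forall t, t \in W -> t \in Good -> j \in Bad t.
    have /= := select j; rewrite -/J; case: ifP => [many | few].
      case=> mu med Dj; exists [set t in J | 5 * delta < `|v t j - s j|].
        have := median_near _ _ _ _ _ (s j) (5 * delta) med.
        rewrite distrC -Dj => /(_ wrong); rewrite -(ler_nat R) natrM; lra.
      move=> t; rewrite !inE => /andP[jS far] tG; apply/negPn/negP => jB.
      have [_ /(_ jS)] := ok t j tG jB; rewrite leNgt far //.
    move=> Dj; exists (~: J).
      have := cardsC J; move/(congr1 (fun n => n%:R : R)); rewrite natrD.
      by move/negbT: few; rewrite -ltNge; lra.
    (* Here [D j = 0], so the spike at [j] exceeds [5 * delta], and a good trial in which [j] is not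
       exceptional would have retained it. *)
    move=> t; rewrite !inE => jS tG; apply/negPn/negP => jB.
    have [/(_ _)/negP] := ok t j tG jB; rewrite (negPf jS) => large _.
    by apply: large; rewrite Dj subr0 in wrong; lra.
  have sub : W :&: Good \subset [set t | j \in Bad' t].
    apply/subsetP => t; rewrite !inE => /andP[tW tG].
    by rewrite /Bad' tG W_Bad.
  have := subset_leq_card sub; rewrite -(ler_nat R).
  have := cardsUI W Good; move/(congr1 (fun n => n%:R : R)); rewrite !natrD.
  have := max_card (W :|: Good); rewrite -(ler_nat R); lra.
(* A selected position is retained in [9 / 10] of the trials, and each trial retains at most [sigma]
   positions. *)
- suff : #|[set j | (9 / 10 * #|I|%:R <= #|[set t | j \in S t]|%:R :> R)]|%:R
      * (9 / 10 * #|I|%:R) <= #|I|%:R * sigma.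
    move: #|[set j | _]|%:R => x le.
    have : #|I|%:R * (9 * x) <= #|I|%:R * (10 * sigma) by lra.
    by rewrite ler_pM2l.
  by apply: (@double_counting _ _ _ S) => // j; rewrite inE.
- by move=> j; have := select j; rewrite inE /=; case: ifP.
- by move=> j; rewrite inE -leNgt.
Qed.

(** * Scaling, and the effect of one pass on the residual *)

Lemma supp_scale (R : realType) d (c : R) (g : 'cV[R]_d) :
  c != 0 -> supp (c *: g) = supp g.
Proof. by move=> c0; apply/setP => j; rewrite !inE mxE mulf_eq0 negb_or c0. Qed.

Lemma l1normZ (R : realType) d (c : R) (g : 'cV[R]_d) :
  l1norm (c *: g) = `|c| * l1norm g.
Proof. by rewrite /l1norm mulr_sumr; apply: eq_bigr => j _; rewrite mxE normrM. Qed.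

(* This frees the recovery conditions from their normalization of [w]: one
   coordinate of [w] is moved, in the direction of the sign of [w + y] there. *)
Lemma enlarge_noise (R : realType) d (w y : 'cV[R]_d) (om : R) :
  (0 < d)%N -> l1norm w <= om ->
  exists2 w', l1norm w' = om & forall j, `|(w + y) j 0| <= `|(w' + y) j 0|.
Proof.
move=> d_gt0 le_om; pose j0 := Ordinal d_gt0.
pose sg : R := if 0 <= (w + y) j0 0 then 1 else -1.
pose w' := \col_j if j == j0 then sg * (om - l1norm w + `|w j0 0|) else w j 0.
have normsg : `|sg| = 1 by rewrite /sg; case: ifP; rewrite ?normrN normr1.
have amp_ge0 : 0 <= om - l1norm w + `|w j0 0|.
  by rewrite addr_ge0 // subr_ge0.
exists w' => [|j].
  rewrite {1}/l1norm (bigD1 j0) //= mxE eqxx normrM normsg mul1r ger0_norm //.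
  rewrite (eq_bigr (fun j => `|w j 0|)) => [|j /negPf ne]; last by rewrite mxE ne.
  by rewrite [in X in X + _]/l1norm (bigD1 j0) //=; ring.
rewrite [(w' + y) j 0]mxE [w' j 0]mxE; case: eqP => [-> | _]; last by rewrite !mxE.
have := ler_norm (w j0 0); have := ler_norm (- w j0 0); rewrite normrN.
move: amp_ge0; rewrite /sg !mxE; move: `|w j0 0| => z amp_ge0 leN le.
case: ifP => [pos | /negbT]; first by rewrite mul1r !ger0_norm; lra.
by rewrite -ltNge => neg; rewrite mulN1r !ler0_norm; lra.
Qed.

Section Pass.
Variables (R : realType) (a c1 c2 : R) (d m : nat).
Variable A : 'M[R]_(nmeas a c1 c2 d m, d).
Hypothesis isoA : isolation_matrix A.

Lemma block_measurement (k : 'I_(npasses a m)) (t : 'I_(ntrials c1 d k))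
    (g : 'cV[R]_d) n b :
  block (vec_mx (Phi A *m g)^T)^T t n b =
    \sum_j bit_test R d b j * (block A t n j * g j 0).
Proof.
rewrite !mxE; apply: eq_bigr => j _.
by rewrite mxE mxvecE mxE mulrA [in RHS]/block !mxE.
Qed.

(** Exactly one 1 per column makes a block the graph of a map from positions to rows, the form in
    which a single trial is analysed. *)
Lemma isolation_row (k : 'I_(npasses a m)) (t : 'I_(ntrials c1 d k)) :
  exists r : 'I_d -> 'I_(nrows c2 m k),
    forall n j, block A t n j = (r j == n)%:R.
Proof.
have [A01 A1] := isoA.
have /fin_all_exists[r rE] : forall j : 'I_d, exists n,
    [set n | block A t n j == 1] = [set n].
  by move=> j; apply/cards1P; rewrite A1.
exists r => n j; have : n \in [set n | block A t n j == 1] = (n == r j).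
  by rewrite rE inE.
rewrite inE [r j == n]eq_sym => <-.
have [] : block A t n j = 0 \/ block A t n j = 1 by rewrite !mxE; exact: A01.
  by move=> ->; rewrite eq_sym oner_eq0.
by move=> ->; rewrite eqxx.
Qed.

(** Dividing by [mu] after enlarging [w] to the exact norm gives an admissible vector. The enlarged
    noise dominates the actual one at each position, so a row quiet for the former is quiet for the
    latter. *)
Lemma CRC_scaled (k : 'I_(npasses a m)) (s w : 'cV[R]_d) (nu : nat -> 'cV[R]_d)
    (mu : R) :
  CRC A -> (0 < d)%N -> 0 < mu -> #|supp s|%:R <= sparsity a m k ->
  l1norm w <= mu * (4 * 10 ^+ 5 * a)^-1 ->
  (forall i, (i < k)%N -> #|supp (nu i)|%:R <= 3 * sparsity a m i /\
     forall j, `|nu i j 0| <= mu * (2 / sparsity a m i)) ->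
  exists2 Good : {set 'I_(ntrials c1 d k)},
    99 / 100 * (ntrials c1 d k)%:R <= #|Good|%:R :> R &
    forall t, t \in Good ->
      #|[set j in supp s | ~~ isolated (block A t) s j]|%:R
        <= sparsity a m k.+1 / 100 /\
      #|[set n | ~~ (\sum_(j | block A t n j == 1)
                        `|(w + \sum_(i < k) nu i) j 0|
                      <= mu * (1000 * sparsity a m k)^-1)]|%:R
        <= sparsity a m k.+1 / 100.
Proof.
move=> crcA d_gt0 mu_gt0 sparse_s small_w nu_ok.
have mu_neq0 : mu != 0 by rewrite gt_eqF.
have muV_neq0 : mu^-1 != 0 by rewrite invr_eq0.
have muV_gt0 : 0 < mu^-1 by rewrite invr_gt0.
have [w' w'_norm w'_le] := enlarge_noise R d w (\sum_(i < k) nu i) _ d_gt0 small_w.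
have adm : admissible a m (mu^-1 *: s) (mu^-1 *: w') (fun i : 'I_k => mu^-1 *: nu i).
  split.
  - by rewrite supp_scale.
  - by rewrite l1normZ w'_norm gtr0_norm // mulKf.
  - move=> i; have [sp mag] := nu_ok i (ltn_ord i); rewrite supp_scale //; split=> // j.
    by rewrite mxE normrM gtr0_norm // ler_pdivrMl.
exists [set t | good_trial a m (block A t) k (mu^-1 *: s)
         (mu^-1 *: w' + \sum_(i < k) mu^-1 *: nu i)]; first exact: crcA adm.
move=> t; rewrite inE => /andP[iso quiet]; split.
  by move: iso; rewrite /isolated supp_scale.
apply: le_trans quiet; rewrite ler_nat; apply/subset_leq_card/subsetP => n.
rewrite !inE; apply: contra; rewrite -scaler_sumr -scalerDr => le_q.
rewrite -ler_pdivrMl //; apply: le_trans le_q; rewrite mulr_sumr.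
apply: ler_sum => j _; rewrite [in X in _ <= X]mxE normrM gtr0_norm //.
by rewrite ler_pM2l.
Qed.

(** The part [s - (h' - h)] of the new residual is split: its values on [Fail] form [s'], the others
    form [nu'], which lives on old spikes and selected positions. The vote bounds these supports by
    [(6 / 9) m_(k+1)] and [(1 + 10 / 9) m_k]. *)
Lemma pass_step (k : 'I_(npasses a m)) (f h h' s w : 'cV[R]_d)
    (nu : nat -> 'cV[R]_d) (mu : R) :
  CRC A -> 1 <= a -> 0 < c1 -> (1 < d)%N -> (0 < m)%N -> 0 < mu ->
  f - h = s + w + \sum_(i < k) nu i ->
  #|supp s|%:R <= sparsity a m k ->
  l1norm w <= mu * (4 * 10 ^+ 5 * a)^-1 ->
  (forall i, (i < k)%N -> #|supp (nu i)|%:R <= 3 * sparsity a m i /\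
     forall j, `|nu i j 0| <= mu * (2 / sparsity a m i)) ->
  pass k (Phi A *m f - Phi A *m h) h h' ->
  exists s' nu' : 'cV[R]_d,
    [/\ f - h' = s' + w + (\sum_(i < k) nu i + nu'),
        #|supp s'|%:R <= sparsity a m k.+1,
        #|supp nu'|%:R <= 3 * sparsity a m k,
        forall j, `|nu' j 0| <= mu * (2 / sparsity a m k) &
        #|supp h'|%:R <= #|supp h|%:R + 2 * sparsity a m k].
Proof.
move=> crcA a_ge1 c1_gt0 d_gt1 m_gt0 mu_gt0 resE sparse_s small_w nu_ok.
have a_gt0 : 0 < a by lra.
have sp_gt0 i : 0 < sparsity a m i by rewrite divr_gt0 ?ltr0n ?exprn_gt0.
(* Without a trial every position would pass the vote with an arbitrary median; [1 < d] and [0 < c1]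
   rule this out. *)
have T_gt0 : (0 < ntrials c1 d k)%N.
  rewrite absz_gt0 gt_eqF // ceil_gt0 mulr_gt0 ?mulr_gt0 ?ltr0n //.
  by rewrite ln_gt0 // ltr1n.
case=> S [v [out select]].
have [Good many_good good] :=
  CRC_scaled k s w nu mu crcA (ltnW d_gt1) mu_gt0 sparse_s small_w nu_ok.
set e := w + \sum_(i < k) nu i in good.
set delta := mu * (1000 * sparsity a m k)^-1 in good.
have delta_ge0 : 0 <= delta.
  by rewrite ltW // mulr_gt0 // invr_gt0 mulr_gt0 // ltr0n.
have E : Phi A *m f - Phi A *m h = Phi A *m (s + e).
  by rewrite -mulmxBr resE addrA.
(* The factor 3 of [trial_exceptions] meets two bounds [m_(k+1) / 100], for noisy rows and for
   spikes that are not isolated. *)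
pose beta := 6 * (sparsity a m k.+1 / 100).
have /fin_all_exists[Bad Bad_ok] : forall t, exists Bad : {set 'I_d}, t \in Good ->
    #|Bad|%:R <= beta /\ forall j, j \notin Bad ->
      (3 * delta < `|s j 0| -> j \in S t) /\
      (j \in S t -> `|v t j - s j 0| <= 5 * delta).
  move=> t; have [tG | tG] := boolP (t \in Good); last by exists set0.
  have [alone_le quiet_le] := good t tG.
  have [r rE] := isolation_row k t.
  have XE n b : block (vec_mx (Phi A *m f - Phi A *m h)^T)^T t n b =
      \sum_(j | r j == n) bit_test R d b j * (s + e) j 0.
    rewrite E block_measurement [RHS]big_mkcond; apply: eq_bigr => j _.
    by rewrite rE; case: eqP; rewrite ?mul1r ?mul0r ?mulr0.
  have [Bad [card_Bad BadP]] := trial_exceptions R d _ r s e delta _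
     delta_ge0 XE a m k (S t) (v t) (out t) sparse_s.
  exists Bad => _; split=> //.
  have block1 n j : (block A t n j == 1) = (r j == n).
    by rewrite rE; case: (r j == n); rewrite ?eqxx // eq_sym oner_eq0.
  have -> : beta = 3 * (sparsity a m k.+1 / 100 + sparsity a m k.+1 / 100).
    by rewrite /beta; ring.
  apply: le_trans (ler_wpM2l _ (lerD quiet_le alone_le)) => //.
  rewrite -natrD -[3]/(3%:R) -natrM ler_nat; apply: leq_trans card_Bad _.
  rewrite leq_mul2l /=; apply: leq_add; apply/subset_leq_card/subsetP => x.
    by rewrite !inE /quiet (eq_bigl _ _ (block1 x)).
  rewrite !inE => /andP[-> /=]; apply: contra => /existsP[n /andP[]].
  rewrite block1 => /eqP rx /forall_inP iso; apply/forall_inP => i iS.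
  by have := iso i iS; rewrite block1 -rx.
have beta_ge0 : 0 <= beta by rewrite mulr_ge0 // divr_ge0 // ltW.
have [||||||Fail [Sel [card_Fail card_Sel Sel_h Fail_h]]] :=
    @vote_exceptions R d _ S Bad v (fun j => s j 0) (fun j => (h' - h) j 0) Good delta
      beta (sparsity a m k) _ delta_ge0 beta_ge0.
- by rewrite card_ord.
- by rewrite card_ord.
- by move=> t /Bad_ok[].
- by move=> t j /Bad_ok[_]; exact.
- move=> t; have [_ [_ -> _]] := out t.
  apply: le_trans (_ : (Num.truncn (sparsity a m k))%:R <= _).
    by rewrite ler_nat geq_minl.
  by rewrite truncn_le ltW.
- move=> j /=; rewrite card_ord; have /= := select j; case: ifP => _.
    by case=> x med h'E; exists x; rewrite // !mxE h'E addrAC subrr add0r.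
  by rewrite !mxE => ->; rewrite subrr.
exists (\col_j if j \in Fail then (s - (h' - h)) j 0 else 0).
exists (\col_j if j \in Fail then 0 else (s - (h' - h)) j 0).
split.
- rewrite -(subrKA h f (- h')) resE; apply/matrixP => i j.
  by rewrite ord1 !mxE; case: ifP => _; ring.
- apply: (@le_trans _ _ #|Fail|%:R).
    rewrite ler_nat; apply/subset_leq_card/subsetP => j; rewrite !inE mxE.
    by case: ifP; rewrite ?eqxx.
  by move: card_Fail (sp_gt0 k.+1); rewrite /beta; lra.
- apply: (@le_trans _ _ (#|supp s| + #|Sel|)%:R).
    rewrite ler_nat; apply: leq_trans (leq_card_setU _ _).
    apply/subset_leq_card/subsetP => j; rewrite in_setU !inE mxE.
    case: ifP; rewrite ?eqxx // => _; apply: contraR; rewrite negb_or negbK.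
    by move=> /andP[/eqP s0 /Sel_h]; rewrite !mxE s0 => ->; rewrite subrr.
  by rewrite natrD; move: card_Sel sparse_s (sp_gt0 k); lra.
- move=> j; rewrite mxE.
  (* The error [5 * delta] is far below the allowed size. *)
  have -> : mu * (2 / sparsity a m k) = 2000 * delta.
    by rewrite /delta; field; rewrite gt_eqF.
  case: ifP => [_ | /negbT/Fail_h]; first by rewrite normr0; lra.
  by rewrite !mxE; lra.
- apply: (@le_trans _ _ (#|supp h| + #|Sel|)%:R).
    rewrite ler_nat; apply: leq_trans (leq_card_setU _ _).
    apply/subset_leq_card/subsetP => j; rewrite in_setU !inE.
    apply: contraR; rewrite negb_or negbK => /andP[/eqP h0 /Sel_h].
    by rewrite !mxE h0 subr0 => ->.
  by rewrite natrD; move: card_Sel (sp_gt0 k); lra.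
Qed.

End Pass.

(** * Existence of a run of the algorithm *)

Lemma trial_outcome_exists (R : realType) (a : R) d m q
    (X : 'M[R]_(q, (up_log 2 d).+1)) k :
  exists S (v : 'I_d -> R), trial_outcome a m X k S v.
Proof.
have /fin_all_exists[v v_kept] : forall j : 'I_d, exists x : R, j \in decoded X ->
    exists n, [/\ decodes X n j, x = X n ord0 &
      forall n', decodes X n' j -> `|X n' ord0| <= `|x|].
  move=> j; have [|jD] := boolP (j \in decoded X); last by exists 0.
  rewrite inE => /existsP[n0 dec0].
  have [|n] := @set_argmax R _ [set n | decodes X n j] (fun n => `|X n ord0|) n0.
    by rewrite inE.
  rewrite inE => dec_n nmax; exists (X n ord0) => _; exists n; split=> // n' dec'.
  by apply: nmax; rewrite inE.
have [S topS] := is_top_exists R d (Num.truncn (sparsity a m k)) (decoded X)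
  (fun j => `|v j|).
by exists S, v.
Qed.

Lemma pass_exists (R : realType) (a c1 c2 : R) d m (k : 'I_(npasses a m))
    (U : 'cV[R]_((up_log 2 d).+1 * nmeas a c1 c2 d m)) (h : 'cV[R]_d) :
  exists h', pass k U h h'.
Proof.
have /fin_all_exists[S /fin_all_exists[v out]] := fun t : 'I_(ntrials c1 d k) =>
  trial_outcome_exists R a d m _ (block (vec_mx U^T)^T t) k.
have /fin_all_exists[mu med] := fun j : 'I_d =>
  is_median_exists R _ [set t | j \in S t] (v^~ j).
exists (h + \col_j if 9 / 10 * (ntrials c1 d k)%:R
                   <= #|[set t | j \in S t]|%:R :> R then mu j else 0).
exists S, v; split=> // j /=; case: ifP => sel; last by rewrite !mxE sel addr0.
by exists (mu j); rewrite // !mxE sel.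
Qed.

(** A run is extended one pass at a time, since pass [k] makes sense only for [k < npasses a m]. *)
Lemma chaining_pursuit_exists (R : realType) (a c1 c2 : R) d m
    (F : 'M[R]_((up_log 2 d).+1 * nmeas a c1 c2 d m, d)) V :
  exists fhat, chaining_pursuit_proper F V fhat.
Proof.
suff [h h0 hP] : exists2 h : nat -> 'cV[R]_d, h 0%N = 0 &
    forall k : 'I_(npasses a m), pass k (V - F *m h k) (h k) (h k.+1).
  by exists (h (npasses a m)), h.
have next (h : 'cV[R]_d) (k : 'I_(npasses a m)) := pass_exists R a c1 c2 d m k (V - F *m h) h.
suff main n : (n <= npasses a m)%N -> exists2 h : nat -> 'cV[R]_d, h 0%N = 0 &
    forall k : 'I_(npasses a m), (k < n)%N -> pass k (V - F *m h k) (h k) (h k.+1).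
  by have [h h0 hP] := main _ (leqnn _); exists h => // k; apply: hP.
elim: n => [|n IHn] ltn; first by exists (fun=> 0).
have [h h0 hP] := IHn (ltnW ltn).
have [h' h'P] := next (h n) (Ordinal ltn).
exists (fun i => if (i <= n)%N then h i else h') => // k.
rewrite ltnS => lek; have /predU1P[kn | ltk] : (k == n :> nat) || (k < n)%N.
    by rewrite -leq_eqVlt.
  have -> : k = Ordinal ltn by apply: val_inj.
  by rewrite /= leqnn ltnn.
by rewrite (ltnW ltk) ltk; apply: hP.
Qed.

(** * Error and support bounds after the last pass *)

Lemma l1normD (R : realType) d (x y : 'cV[R]_d) :
  l1norm (x + y) <= l1norm x + l1norm y.
Proof.
by rewrite /l1norm -big_split /=; apply: ler_sum => j _; rewrite mxE ler_normD.
Qed.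

Lemma l1norm_eq0 (R : realType) d (x : 'cV[R]_d) : l1norm x <= 0 -> x = 0.
Proof.
move=> le0; apply/matrixP => j i; rewrite ord1 [RHS]mxE; apply/eqP.
rewrite -normr_le0; apply: le_trans le0.
by rewrite /l1norm (bigD1 j) //= lerDl sumr_ge0.
Qed.

Lemma l1norm_supp (R : realType) d (x : 'cV[R]_d) (M : R) :
  (forall j, `|x j 0| <= M) -> l1norm x <= #|supp x|%:R * M.
Proof.
move=> xM; rewrite /l1norm (bigID (mem (supp x))) /= [X in _ + X]big1 ?addr0.
  by rewrite mulr_natl -sumr_const; apply: ler_sum.
by move=> j; rewrite inE negbK => /eqP ->; rewrite normr0.
Qed.

Section Recovery.
Variables (R : realType) (a c1 c2 : R) (d m : nat).
Variable A : 'M[R]_(nmeas a c1 c2 d m, d).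
Hypotheses (isoA : isolation_matrix A) (crcA : CRC A).
Hypotheses (a_ge2 : 2 <= a) (c1_gt0 : 0 < c1) (d_gt1 : (1 < d)%N) (m_gt0 : (0 < m)%N).
Variables (f fm : 'cV[R]_d).
Hypothesis best : best_approx m f fm.

Let a_gt0 : 0 < a. Proof. by move: a_ge2; lra. Qed.

Lemma sparsity_gt0 i : 0 < sparsity a m i.
Proof. by rewrite divr_gt0 ?ltr0n ?exprn_gt0. Qed.

Lemma card_best_approx : (#|supp fm| <= m)%N.
Proof.
case: best => S [_ cardS _] ->; apply: (@leq_trans #|S|).
  apply/subset_leq_card/subsetP => j; rewrite !inE mxE.
  by case: ifP; rewrite ?eqxx.
by rewrite cardS geq_minl.
Qed.

(** In the last clause [4 * m_n] acts as a potential: a pass adds at most [2 * m_n] positions to the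
    support, and because [2 <= a] the potential drops by at least as much. *)
Lemma residual_structure (h : nat -> 'cV[R]_d) (mu : R) :
  0 < mu -> l1norm (f - fm) <= mu * (4 * 10 ^+ 5 * a)^-1 ->
  h 0%N = 0 ->
  (forall k : 'I_(npasses a m),
     pass k (Phi A *m f - Phi A *m h k) (h k) (h k.+1)) ->
  forall n, (n <= npasses a m)%N -> exists (s : 'cV[R]_d) (nu : nat -> 'cV[R]_d),
  [/\ f - h n = s + (f - fm) + \sum_(i < n) nu i,
      #|supp s|%:R <= sparsity a m n,
      forall i, (i < n)%N -> #|supp (nu i)|%:R <= 3 * sparsity a m i /\
        forall j, `|nu i j 0| <= mu * (2 / sparsity a m i) &
      #|supp (h n)|%:R + 4 * sparsity a m n <= 4 * m%:R :> R].
Proof.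
move=> mu_gt0 small h0 passes; elim=> [|n IHn] ltn.
  exists fm, (fun=> 0); split=> //.
  - by rewrite h0 subr0 big_ord0 addr0 addrC subrK.
  - by rewrite /sparsity expr0 divr1 ler_nat card_best_approx.
  have -> : supp (h 0%N) = set0.
    by apply/setP => j; rewrite !inE h0 mxE eqxx.
  by rewrite cards0 /sparsity expr0 divr1 add0r.
have [s [nu [resE sparse_s nu_ok size_h]]] := IHn (ltnW ltn).
have a_ge1 : 1 <= a by move: a_ge2; lra.
have [s' [nu' [resE' sparse_s' sparse_nu mag_nu size_h']]] :=
  pass_step R a c1 c2 d m A isoA (Ordinal ltn) f (h n) (h n.+1) s (f - fm) nu mu
    crcA a_ge1 c1_gt0 d_gt1 m_gt0 mu_gt0 resE sparse_s small nu_ok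
    (passes (Ordinal ltn)).
exists s', (fun i => if (i < n)%N then nu i else nu'); split=> //.
- rewrite resE' big_ord_recr /= ltnn; congr (_ + (_ + _)).
  by apply: eq_bigr => i _; rewrite ltn_ord.
- move=> i; rewrite ltnS leq_eqVlt => /predU1P[-> | lti]; first by rewrite ltnn.
  by rewrite lti; apply: nu_ok.
- have half : sparsity a m n.+1 * 2 <= sparsity a m n.
    have -> : sparsity a m n = sparsity a m n.+1 * a.
      by rewrite /sparsity exprSr; field; rewrite gt_eqF //= expf_neq0 ?gt_eqF.
    by rewrite ler_pM2l // sparsity_gt0.
  by move: size_h' size_h half => /=; lra.
Qed.

(** The number of passes exceeds [ln m / ln a], so [a ^+ npasses a m] exceeds [m]. *)
Lemma sparsity_npasses : sparsity a m (npasses a m) < 1.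
Proof.
have lna_gt0 : 0 < ln a by rewrite ln_gt0 //; move: a_ge2; lra.
rewrite /sparsity ltr_pdivrMr ?exprn_gt0 // mul1r.
rewrite -ltr_ln ?posrE ?ltr0n ?exprn_gt0 // lnXn // -[ln a *+ _]mulr_natl.
by rewrite -ltr_pdivrMr // truncnS_gt.
Qed.

(** The term [(ln 2)^-1] pays for the additional pass in [npasses], and the maximum with 2 keeps the
    logarithm away from 0 when [m = 1]. *)
Lemma npasses_le :
  (npasses a m)%:R <= ((ln 2)^-1 + (ln a)^-1) * ln (maxn m 2)%:R.
Proof.
have lna_gt0 : 0 < ln a by rewrite ln_gt0 //; move: a_ge2; lra.
have ln2_gt0 : 0 < ln 2 :> R by rewrite ln_gt0 // ltr1n.
have max_gt0 : 0 < (maxn m 2)%:R :> R by rewrite ltr0n leq_max orbT.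
rewrite /npasses -natr1 addrC mulrDl; apply: lerD.
  rewrite mulrC ler_pdivlMr // mul1r ler_ln ?posrE //.
  by rewrite ler_nat leq_maxr.
have lnm_ge0 : 0 <= ln m%:R / ln a.
  by rewrite divr_ge0 ?(ltW lna_gt0) // ln_ge0 // ler1n.
apply: le_trans (_ : _ <= ln m%:R / ln a) _; first by rewrite truncn_le.
rewrite mulrC ler_pM2l ?invr_gt0 // ler_ln ?posrE ?ltr0n //.
  by rewrite ler_nat leq_maxl.
by rewrite leq_max orbT.
Qed.

Lemma recovery_at_scale (fhat : 'cV[R]_d) (mu : R) :
  0 < mu -> l1norm (f - fm) <= mu * (4 * 10 ^+ 5 * a)^-1 ->
  chaining_pursuit_proper (Phi A) (Phi A *m f) fhat ->
  #|supp fhat|%:R <= 4 * m%:R :> R /\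
  l1norm (f - fhat) <= l1norm (f - fm) + (npasses a m)%:R * (6 * mu).
Proof.
move=> mu_gt0 small [h [h0 passes ->]].
have [s [nu [resE sparse_s nu_ok size_h]]] :=
  residual_structure h mu mu_gt0 small h0 passes _ (leqnn _).
split; first by move: size_h (sparsity_gt0 (npasses a m)); lra.
have s0 : s = 0.
  have : #|supp s|%:R < 1%:R :> R by apply: le_lt_trans sparse_s sparsity_npasses.
  rewrite ltr_nat ltnS leqn0 cards_eq0 => /eqP/setP supp0.
  apply/matrixP => j i; rewrite ord1 [RHS]mxE; apply/eqP.
  by have := supp0 j; rewrite !inE => /negbT; rewrite negbK.
rewrite resE s0 add0r; apply: le_trans (l1normD _ _ _ _) _; rewrite lerD2l.
apply: (@le_trans _ _ (\sum_(i < npasses a m) l1norm (nu i))).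
  elim/big_ind2: _ => [|x x' y y' le1 le2|//].
    by rewrite /l1norm big1 // => j _; rewrite mxE normr0.
  exact: le_trans (l1normD _ _ _ _) (lerD le1 le2).
have -> : (npasses a m)%:R * (6 * mu) = \sum_(i < npasses a m) (6 * mu).
  by rewrite sumr_const card_ord mulr_natl.
apply: ler_sum => i _; have [sp mag] := nu_ok i (ltn_ord i).
apply: le_trans (l1norm_supp _ _ _ _ mag) _.
have bound_ge0 : 0 <= mu * (2 / sparsity a m i).
  by rewrite ltW // mulr_gt0 // divr_gt0 // sparsity_gt0.
apply: le_trans (ler_wpM2r bound_ge0 sp) _.
have := sparsity_gt0 i => sp_gt0; rewrite le_eqVlt; apply/orP; left; apply/eqP.
by field; rewrite gt_eqF.
Qed.

Lemma recovery (fhat : 'cV[R]_d) :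
  chaining_pursuit_proper (Phi A) (Phi A *m f) fhat ->
  [/\ #|supp fhat|%:R <= 4 * m%:R :> R,
      l1norm (f - fhat) <=
        (1 + 6 * (4 * 10 ^+ 5 * a) * ((ln 2)^-1 + (ln a)^-1) * ln (maxn m 2)%:R)
          * l1norm (f - fm) &
      fm = f -> fhat = f].
Proof.
move=> run; set w := l1norm (f - fm); set Q := 4 * 10 ^+ 5 * a.
have Q_gt0 : 0 < Q by rewrite mulr_gt0 // mulr_gt0 // exprn_gt0.
have w_ge0 : 0 <= w by rewrite /w /l1norm sumr_ge0.
(* The scale [mu = Q * w + eps] is positive even when [w = 0]. *)
have scale eps : 0 < eps -> w <= (Q * w + eps) * Q^-1.
  by move=> eps_gt0; rewrite ler_pdivlMr // mulrC lerDl ltW.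
have pos eps : 0 < eps -> 0 < Q * w + eps.
  by move=> eps_gt0; rewrite ltr_wpDl // mulr_ge0 // ltW.
(* The support bound does not involve the scale, so any [eps], here 1, gives it. *)
have [card_fhat _] := recovery_at_scale fhat _ (pos 1 ltr01) (scale 1 ltr01) run.
have K_gt0 : 0 < (npasses a m)%:R :> R by rewrite ltr0n.
have err : l1norm (f - fhat) <= (1 + (npasses a m)%:R * (6 * Q)) * w.
  apply/ler_addgt0Pr => eps eps_gt0.
  (* With this choice the error bound exceeds its limit by exactly [eps]. *)
  have eps'_gt0 : 0 < eps / (6 * (npasses a m)%:R) by rewrite divr_gt0 // mulr_gt0.
  have [_ /le_trans] :=
    recovery_at_scale fhat _ (pos _ eps'_gt0) (scale _ eps'_gt0) run; apply.
  rewrite -/w le_eqVlt; apply/orP; left; apply/eqP.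
  by field; rewrite gt_eqF.
split=> //.
  apply: le_trans err _; rewrite ler_wpM2r // lerD2l [leLHS]mulrC -mulrA.
  by rewrite ler_pM2l ?npasses_le // mulr_gt0.
move=> fmE; have w0 : w = 0.
  by rewrite /w fmE subrr /l1norm big1 // => j _; rewrite mxE normr0.
apply/esym/eqP; rewrite -subr_eq0; apply/eqP/l1norm_eq0.
by move: err; rewrite w0 mulr0.
Qed.

End Recovery.

Theorem mainTheorem6 (R : realType) :
  exists a0 : R, forall a : R, a0 <= a ->
  exists C C' : R,
  forall (c1 c2 : R), 0 < c1 -> 0 < c2 ->
  forall (d m : nat), (1 < d)%N -> (0 < m)%N ->
  forall A : 'M[R]_(nmeas a c1 c2 d m, d),
    isolation_matrix A -> CRC A ->
  forall f fm : 'cV[R]_d, best_approx m f fm ->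
    (exists fhat : 'cV[R]_d,
       chaining_pursuit_proper (Phi A) (Phi A *m f) fhat) /\
    (forall fhat : 'cV[R]_d,
       chaining_pursuit_proper (Phi A) (Phi A *m f) fhat ->
       [/\ #|supp fhat|%:R <= C' * m%:R,
           l1norm (f - fhat) <=
             (1 + C * ln (maxn m 2)%:R) * l1norm (f - fm) &
           fm = f -> fhat = f]).
Proof.
(* From [2 <= a] on, the sparsities at least halve from pass to pass and [ln a] is positive. *)
exists 2 => a a_ge2.
exists (6 * (4 * 10 ^+ 5 * a) * ((ln 2)^-1 + (ln a)^-1)), 4.
move=> c1 c2 c1_gt0 _ d m d_gt1 m_gt0 A isoA crcA f fm best.
split; first exact: chaining_pursuit_exists.
exact: recovery best.
Qed.
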